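(* Let $(X,r)$ be an involutive solution. Then $G_{(X,r)}$ is diffuse if and only if $(X,r)$ is multipermutation.
   Context: A solution $(X,r)$ is a finite set $X$ with a bijection $r\colon X\times X\to X\times X$, $r(x,y)=(\sigma_x(y),\tau_y(x))$, satisfying the Yang--Baxter equation $r_1r_2r_1=r_2r_1r_2$ on $X^3$ (where $r_1=r\times \mathrm{Id}_X$, $r_2=\mathrm{Id}_X\times r$), with all maps $\sigma_x,\tau_x\colon X\to X$ bijective. It is involutive if $r^2=\mathrm{Id}$. Its structure group is $G_{(X,r)}=\langle X \mid xy=\sigma_x(y)\tau_y(x) \text{ for all } x,y\in X\rangle$. The retraction $\mathrm{Ret}(X,r)$ of a solution is the solution induced by $r$ on $X/\!\sim$, where $x\sim x'$ if and only if $\sigma_x=\sigma_{x'}$ and $\tau_x=\tau_{x'}$. A solution is multipermutation (MP) of level $n$ if $n$ is the minimal non-negative integer such that $\#\mathrm{Ret}^n(X,r)=1$, where $\mathrm{Ret}^n$ denotes the $n$-fold iterate of $\mathrm{Ret}$ and $\mathrm{Ret}^0(X,r)=(X,r)$; it is multipermutation if it is so of some level $n$. A group $G$ is diffuse if for every finite non-empty subset $A$ of $G$ there exists an $a\in A$ such that for all $g\in G\setminus\{1\}$, either $ga\notin A$ or $g^{-1}a\notin A$. *)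

(* Defs.v *)
From HB Require Import structures.
From mathcomp Require Import all_boot finmap boolp.

Set Implicit Arguments.
Unset Strict Implicit.
Unset Printing Implicit Defensive.

Local Open Scope group_scope.
Local Open Scope fset_scope.
Local Open Scope quotient_scope.

Definition diffuse (G : groupType) : Prop :=
  forall A : {fset G}, A != fset0 ->
    exists2 a, a \in A &
      forall g : G, g != 1 -> (g * a \notin A) \/ (g^-1 * a \notin A).

Section Presentation.
Variable X : choiceType.

(* The letter (x, false) is the generator x, and (x, true) is its formal
   inverse. *)
Definition gword := seq (X * bool).

Variable rel : gword -> gword -> Prop.

Inductive pres_eq : gword -> gword -> Prop :=
| PresRel u v : rel u v -> pres_eq u v
| PresCancel x b : pres_eq [:: (x, b); (x, ~~ b)] [::]
| PresRefl u : pres_eq u u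
| PresSym u v : pres_eq u v -> pres_eq v u
| PresTrans u v w : pres_eq u v -> pres_eq v w -> pres_eq u w
| PresCat u u' v v' :
    pres_eq u u' -> pres_eq v v' -> pres_eq (u ++ v) (u' ++ v').

Definition pres_eqb (u v : gword) : bool := `[< pres_eq u v >].

Lemma pres_eqb_refl : reflexive pres_eqb.
Proof. by move=> u; apply/asboolP; apply: PresRefl. Qed.

Lemma pres_eqb_sym : symmetric pres_eqb.
Proof. by move=> u v; apply/asboolP/asboolP; apply: PresSym. Qed.

Lemma pres_eqb_trans : transitive pres_eqb.
Proof.
by move=> v u w /asboolP uv /asboolP vw; apply/asboolP; apply: PresTrans vw.
Qed.

Canonical pres_equiv :=
  EquivRel pres_eqb pres_eqb_refl pres_eqb_sym pres_eqb_trans.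

Definition presented_group := {eq_quot pres_equiv}.

HB.instance Definition _ := Choice.on presented_group.
HB.instance Definition _ := EqQuotient.on presented_group.

Lemma presP (u v : gword) :
  \pi_presented_group u = \pi_presented_group v <-> pres_eq u v.
Proof. by split=> [/eqmodP/asboolP//|uv]; apply/eqmodP/asboolP. Qed.

Lemma pres_repr (u : gword) : pres_eq (repr (\pi_presented_group u)) u.
Proof. by apply/presP; rewrite reprK. Qed.

Definition gword_inv (u : gword) : gword :=
  rev [seq (l.1, ~~ l.2) | l <- u].

Lemma gword_inv_cat u v : gword_inv (u ++ v) = gword_inv v ++ gword_inv u.
Proof. by rewrite /gword_inv map_cat rev_cat. Qed.

Lemma gword_invK : involutive gword_inv.
Proof.
move=> u; rewrite /gword_inv map_rev revK -map_comp -[RHS]map_id.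
by apply: eq_map => -[x b] /=; rewrite negbK.
Qed.

Lemma pres_invr u : pres_eq (u ++ gword_inv u) [::].
Proof.
elim: u => [|[x b] u IHu]; first exact: PresRefl.
rewrite -cat1s gword_inv_cat -catA (catA u).
apply: (PresTrans (v := [:: (x, b)] ++ ([::] ++ [:: (x, ~~ b)]))).
  apply: PresCat; first exact: PresRefl.
  by apply: PresCat; last exact: PresRefl.
exact: PresCancel.
Qed.

Lemma pres_invl u : pres_eq (gword_inv u ++ u) [::].
Proof. by have := pres_invr (gword_inv u); rewrite gword_invK. Qed.

Lemma pres_inv u v : pres_eq u v -> pres_eq (gword_inv u) (gword_inv v).
Proof.
move=> uv; apply: (PresTrans (v := gword_inv u ++ (v ++ gword_inv v))).
  rewrite -{1}[gword_inv u]cats0; apply: PresCat; first exact: PresRefl.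
  exact/PresSym/pres_invr.
rewrite catA -[X in pres_eq _ X]cat0s; apply: PresCat; last exact: PresRefl.
apply: PresTrans (pres_invl u); apply: PresCat; first exact: PresRefl.
exact: PresSym.
Qed.

Definition pres_one : presented_group := \pi_presented_group [::].
Definition pres_mul (a b : presented_group) : presented_group :=
  \pi_presented_group (repr a ++ repr b).
Definition pres_ginv (a : presented_group) : presented_group :=
  \pi_presented_group (gword_inv (repr a)).

Lemma pres_mulE u v :
  pres_mul (\pi u) (\pi v) = \pi_presented_group (u ++ v).
Proof. by apply/presP; apply: PresCat; apply: pres_repr. Qed.

Lemma pres_ginvE u :
  pres_ginv (\pi u) = \pi_presented_group (gword_inv u).
Proof. by apply/presP; apply/pres_inv/pres_repr. Qed.

Lemma pres_mulA : associative pres_mul.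
Proof.
by elim/quotW=> u; elim/quotW=> v; elim/quotW=> w; rewrite !pres_mulE catA.
Qed.

Lemma pres_mul1g : left_id pres_one pres_mul.
Proof. by elim/quotW=> u; rewrite pres_mulE. Qed.

Lemma pres_mulg1 : right_id pres_one pres_mul.
Proof. by elim/quotW=> u; rewrite pres_mulE cats0. Qed.

Lemma pres_mulVg : left_inverse pres_one pres_ginv pres_mul.
Proof.
by elim/quotW=> u; rewrite pres_ginvE pres_mulE; apply/presP/pres_invl.
Qed.

Lemma pres_mulgV : right_inverse pres_one pres_ginv pres_mul.
Proof.
by elim/quotW=> u; rewrite pres_ginvE pres_mulE; apply/presP/pres_invr.
Qed.

HB.instance Definition _ := isGroup.Build presented_group
  pres_mulA pres_mul1g pres_mulg1 pres_mulVg pres_mulgV.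

End Presentation.

Section BraidMaps.
Variables (X : Type) (r : X * X -> X * X).

Definition sigma (x y : X) : X := (r (x, y)).1.
Definition tau (y x : X) : X := (r (x, y)).2.

Definition r1 (t : X * X * X) : X * X * X :=
  let: (x, y, z) := t in (sigma x y, tau y x, z).
Definition r2 (t : X * X * X) : X * X * X :=
  let: (x, y, z) := t in (x, sigma y z, tau z y).

Definition yang_baxter : Prop := forall t, r1 (r2 (r1 t)) = r2 (r1 (r2 t)).

End BraidMaps.

Record solution := Solution {
  sol_sort :> finType;
  sol_map : sol_sort * sol_sort -> sol_sort * sol_sort;
  sol_bij : bijective sol_map;
  sol_yb : yang_baxter sol_map;
  sol_sigma_bij : forall x, bijective (sigma sol_map x);
  sol_tau_bij : forall x, bijective (tau sol_map x)
}.

Definition involutive_solution (S : solution) : Prop :=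
  involutive (@sol_map S).

Inductive structure_rel (S : solution) : gword S -> gword S -> Prop :=
| StructureRel x y :
    structure_rel [:: (x, false); (y, false)]
      [:: (sigma (@sol_map S) x y, false); (tau (@sol_map S) y x, false)].

Definition structure_group (S : solution) : groupType :=
  presented_group (@structure_rel S).

Lemma surj_bij (T : finType) (f : T -> T) :
  (forall y, exists x, f x = y) -> bijective f.
Proof.
move=> f_surj; apply: injF_bij; apply/injectiveP/card_uniqP.
rewrite size_codom; apply: eq_card => y; rewrite inE.
by have [x <-] := f_surj y; rewrite codom_f.
Qed.

Section Retraction.
Variable S : solution.
Notation r := (@sol_map S).
Notation s := (sigma r).
Notation t := (tau r).

Definition ret_rel (x x' : S) : bool :=
  [forall y, s x y == s x' y] && [forall y, t x y == t x' y].

Lemma ret_relP x x' : reflect (s x =1 s x' /\ t x =1 t x') (ret_rel x x').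
Proof.
by apply: (iffP andP) => -[h1 h2]; split;
  do ?[by move=> y; apply/eqP; apply: (forallP h1)
      |by move=> y; apply/eqP; apply: (forallP h2)
      |by apply/forallP=> y; apply/eqP].
Qed.

Lemma ret_rel_refl : reflexive ret_rel.
Proof. by move=> x; apply/ret_relP. Qed.

Lemma ret_rel_sym : symmetric ret_rel.
Proof.
by move=> x y; apply/ret_relP/ret_relP => -[h1 h2]; split; apply: fsym.
Qed.

Lemma ret_rel_trans : transitive ret_rel.
Proof.
move=> y x z /ret_relP[h1 h2] /ret_relP[h3 h4].
by apply/ret_relP; split; [apply: ftrans h3|apply: ftrans h4].
Qed.

Canonical ret_equiv := EquivRel ret_rel ret_rel_refl ret_rel_sym ret_rel_trans.

Definition ret_sort := {eq_quot ret_equiv}.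

HB.instance Definition _ := Quotient.on ret_sort.
HB.instance Definition _ := [Finite of ret_sort by <:%/].

Lemma ret_piP x y : reflect (\pi_ret_sort x = \pi_ret_sort y) (ret_rel x y).
Proof. exact: (iffP (eqmodP ret_equiv _ _)). Qed.

Lemma ret_piE x y :
  \pi_ret_sort x = \pi_ret_sort y <-> (s x =1 s y /\ t x =1 t y).
Proof. by split=> [/ret_piP/ret_relP|/ret_relP/ret_piP]. Qed.

Lemma sigma_yb x y z : s (s x y) (s (t y x) z) = s x (s y z).
Proof. by have [-> _ _] := sol_yb (x, y, z). Qed.

Lemma tau_yb x y z : t z (t y x) = t (t z y) (t (s y z) x).
Proof. by have [_ _ ->] := sol_yb (x, y, z). Qed.

Lemma ret_sigma x y x' y' :
  ret_rel x x' -> ret_rel y y' -> ret_rel (s x y) (s x' y').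
Proof.
move=> /ret_relP[sx _] /ret_relP[sy ty]; rewrite -sx.
apply/ret_relP; split=> z.
  have [k _ Kk] := sol_sigma_bij (t y x).
  by rewrite -(Kk z) sigma_yb [in RHS]ty sigma_yb sy.
apply: (bij_inj (sol_tau_bij (t y x))).
by rewrite -tau_yb [in RHS]ty -tau_yb ty.
Qed.

Lemma ret_tau x y x' y' :
  ret_rel x x' -> ret_rel y y' -> ret_rel (t y x) (t y' x').
Proof.
move=> /ret_relP[sx tx] /ret_relP[_ ty]; rewrite -ty.
apply/ret_relP; split=> z.
  apply: (bij_inj (sol_sigma_bij (s x y))).
  by rewrite sigma_yb [in RHS]sx sigma_yb sx.
have [k _ Kk] := sol_tau_bij (s x y).
by rewrite -(Kk z) -tau_yb [in RHS]sx -tau_yb tx.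
Qed.

Local Notation cl := (\pi_ret_sort).

Definition ret_map (p : ret_sort * ret_sort) : ret_sort * ret_sort :=
  (cl (s (repr p.1) (repr p.2)), cl (t (repr p.2) (repr p.1))).

Lemma ret_rel_repr x : ret_rel (repr (cl x)) x.
Proof. by apply/ret_piP; rewrite reprK. Qed.

Lemma ret_mapE x y :
  ret_map (cl x, cl y) = (cl (s x y), cl (t y x)).
Proof.
by congr pair; apply/ret_piP; [apply: ret_sigma|apply: ret_tau];
  apply: ret_rel_repr.
Qed.

Lemma ret_sigmaE x y : sigma ret_map (cl x) (cl y) = cl (s x y).
Proof. by rewrite /sigma ret_mapE. Qed.

Lemma ret_tauE x y : tau ret_map (cl y) (cl x) = cl (t y x).
Proof. by rewrite /tau ret_mapE. Qed.

Lemma ret_bij : bijective ret_map.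
Proof.
apply: surj_bij => -[]; elim/quotW=> u; elim/quotW=> v.
have [k _ Kk] := @sol_bij S; exists (cl (k (u, v)).1, cl (k (u, v)).2).
by rewrite ret_mapE /sigma /tau -surjective_pairing Kk.
Qed.

Lemma ret_yb : yang_baxter ret_map.
Proof.
move=> [[]]; elim/quotW=> x; elim/quotW=> y; elim/quotW=> z.
have r1E (u v w : S) : r1 ret_map (cl u, cl v, cl w) =
    (cl (s u v), cl (t v u), cl w) by rewrite /r1 ret_sigmaE ret_tauE.
have r2E (u v w : S) : r2 ret_map (cl u, cl v, cl w) =
    (cl u, cl (s v w), cl (t w v)) by rewrite /r2 ret_sigmaE ret_tauE.
rewrite (r1E x y z) (r2E x y z) (r2E (s x y)) (r1E x) r1E r2E.
by have [-> -> ->] := sol_yb (x, y, z).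
Qed.

Lemma ret_sigma_bij a : bijective (sigma ret_map a).
Proof.
elim/quotW: a => x; apply: surj_bij; elim/quotW=> y.
by have [k _ Kk] := sol_sigma_bij x; exists (cl (k y)); rewrite ret_sigmaE Kk.
Qed.

Lemma ret_tau_bij a : bijective (tau ret_map a).
Proof.
elim/quotW: a => y; apply: surj_bij; elim/quotW=> x.
by have [k _ Kk] := sol_tau_bij y; exists (cl (k x)); rewrite ret_tauE Kk.
Qed.

Definition ret : solution :=
  Solution ret_bij ret_yb ret_sigma_bij ret_tau_bij.

End Retraction.

Definition mp_level (S : solution) (n : nat) : Prop :=
  #|iter n ret S| = 1%N /\ forall m, (m < n)%N -> #|iter m ret S| <> 1%N.

Definition multipermutation (S : solution) : Prop := exists n, mp_level S n.

(* Main.v *)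
Require Import Defs.
From mathcomp Require Import all_boot.
From mathcomp Require Import all_order all_algebra finmap boolp zify ring.

(** Write G for the structure group and Z for the lattice of integer-valued
    functions on S. The maps sigma_x extend to an action lam of G on S, hence
    on Z by permuting coordinates (move), and sending a generator to the
    corresponding basis vector extends to a 1-cocycle
    coc : G -> Z, coc (g h) = coc g + g . coc h. The cocycle is bijective
    (cocK, from_cocK), so G acts on Z simply transitively by the affine maps
    v |-> coc g + g . v: it is a crystallographic group whose holonomy
    permutes the basis of Z.

    Multipermutation implies diffuse, by induction on the level. Elements
    acting trivially on S form, through coc, a lattice of translations. In a
    finite subset of G, an element whose cocycle has maximal Euclidean norm is
    extremal for them, since v + t and v - t cannot both be at most as long as
    v when t <> 0 (extremal_for_kernel). The map from G to the structure group
    of the retraction has only such elements in its kernel, because sigma_x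
    depends on the class of x only (ret_hom_ker); an extremal point of the
    image, followed by one in the fibre above it, gives an extremal point
    (diffuse_ext).

    Diffuse implies multipermutation. If S is not multipermutation, its
    iterated retractions stabilise at an irretractable solution Y with more
    than one element. For a set P of self-maps of S, let H(P) be the set of
    elements of G whose cocycle is orthogonal to all P-invariant functions, and
    let P' be the set of permutations lam h, h in H(P) (balanced_elt,
    induced). Starting with the set of all self-maps, iterate P |-> P'. The
    sets decrease, and each of them moves some point of S to a point with a
    different image in Y: if m in P moves x to y in this way, then H(P)
    contains h with coc h = e_x - e_y, and if h acted trivially on Y, then x
    and y would be identified in the retraction of Y (moves_induced). So the
    iteration stops at some P = P' with H(P) <> 1. Now H = H(P) is a
    group of affine maps of a lattice in which no nonzero vector is fixed by
    all linear parts of H.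

    Such an H is not diffuse, because balls in it have no extremal point. Let
    a be in a ball of large radius and u = a^-1 . coc a. One looks for h in H
    such that both coc (a h) = a . (u + coc h) and
    coc (a h^-1) = a . (u - h^-1 . coc h) are in the ball; when u is long, it
    suffices that <u, coc h> is very negative and <h . u, coc h> very
    positive. As the coordinates of u cannot be constant on the orbit of the
    maximal one, there is a level theta, with a wide gap down to the
    coordinates of u below it, that some linear part h carries a coordinate
    across. If i is the indicator
    of the coordinates at least theta, then w = h . i - i satisfies
    <u, w> < 0 < <h . u, w> with a margin proportional to u (superlevel_gap),
    by the rearrangement inequality. As the elements acting trivially on S have
    finite index, one can change coc h by a large multiple of w without
    changing the linear part h (coc_ker_multiple), and this proves the claim
    (exists_shrinking, not_diffuse). *)

Set Implicit Arguments.
Unset Strict Implicit.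
Unset Printing Implicit Defensive.

Import Order.TTheory GRing.Theory Num.Theory.
Local Open Scope quotient_scope.
Local Open Scope ring_scope.

(** * Actions and homomorphisms of presented groups *)

Section PresentedAction.
Variables (X : choiceType) (rel : gword X -> gword X -> Prop).
Local Notation G := (presented_group rel).

Local Notation cls := (\pi_(presented_group rel)).

Definition gen (x : X) : G := cls [:: (x, false)].

Lemma pi_cat (u v : gword X) : cls (u ++ v) = (cls u * cls v)%g :> G.
Proof. by rewrite -pres_mulE. Qed.

Lemma pi_nil : cls [::] = 1%g :> G.
Proof. by []. Qed.

Lemma pi_letter x b :
  cls [:: (x, b)] = (if b then (gen x)^-1 else gen x)%g :> G.
Proof. by case: b => //; rewrite /gen -[RHS]/(pres_ginv _) pres_ginvE. Qed.

Lemma presented_ind (P : G -> Prop) :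
  P 1%g -> (forall x g, P g -> P (gen x * g)%g) ->
  (forall x g, P g -> P ((gen x)^-1 * g)%g) -> forall g, P g.
Proof.
move=> P1 Pg PV; elim/quotW; elim=> [|[x b] w IH]; first by rewrite pi_nil.
rewrite -cat1s pi_cat pi_letter; case: b; first exact: PV.
exact: Pg.
Qed.

Lemma presented_ind_rev (P : G -> Prop) :
  P 1%g -> (forall x g, P g -> P (g * gen x)%g) ->
  (forall x g, P g -> P (g * (gen x)^-1)%g) -> forall g, P g.
Proof.
move=> P1 Pg PV g; rewrite -[g]invgK.
elim/presented_ind: (g^-1)%g => [|x h IH|x h IH]; rewrite ?invg1 ?invgM ?invgK //.
- exact: PV.
- exact: Pg.
Qed.

Variables (T : Type) (f f' : X -> T -> T).
Hypotheses (fK : forall x, cancel (f x) (f' x)).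
Hypotheses (f'K : forall x, cancel (f' x) (f x)).

(** Words act through plain maps, so that a single construction serves finite
    sets, lattices and groups. *)
Definition wact (w : gword X) (t : T) : T :=
  foldr (fun l t => if l.2 then f' l.1 t else f l.1 t) t w.

Hypothesis f_rel : forall u v, rel u v -> wact u =1 wact v.

Lemma wact_cat u v t : wact (u ++ v) t = wact u (wact v t).
Proof. exact: foldr_cat. Qed.

Lemma wact_pres u v : pres_eq rel u v -> wact u =1 wact v.
Proof.
elim=> {u v} [u v /f_rel //|x [] t||u v _ IH t|u v w _ IH1 _ IH2 t|
  u u' v v' _ IH1 _ IH2 t] //=.
- exact: fK.
- exact: f'K.
- by rewrite IH1.
- by rewrite !wact_cat IH2 IH1.
Qed.

Definition gact (g : G) : T -> T := wact (repr g).

Lemma gact_pi w : gact (cls w) =1 wact w.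
Proof. exact/wact_pres/pres_repr. Qed.

Lemma gact1 t : gact 1%g t = t.
Proof. by rewrite -pi_nil gact_pi. Qed.

Lemma gactM g h t : gact (g * h)%g t = gact g (gact h t).
Proof.
by elim/quotW: g => u; elim/quotW: h => v; rewrite -pi_cat !gact_pi wact_cat.
Qed.

Lemma gact_gen x t : gact (gen x) t = f x t.
Proof. by rewrite gact_pi. Qed.

Lemma gactK g : cancel (gact g) (gact g^-1%g).
Proof. by move=> t; rewrite -gactM mulVg gact1. Qed.

Lemma gactVK g : cancel (gact g^-1%g) (gact g).
Proof. by move=> t; rewrite -gactM mulgV gact1. Qed.

Lemma gact_genV x t : gact (gen x)^-1%g t = f' x t.
Proof. by rewrite -{1}[t](f'K x) -gact_gen gactK. Qed.

End PresentedAction.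

(** A homomorphism to H is the orbit map at 1 of an action on H by left
    multiplications. *)
Section PresentedMorphism.
Variables (X : choiceType) (rel : gword X -> gword X -> Prop).
Local Notation G := (presented_group rel).
Variables (H : groupType) (phi : X -> H).

Local Notation mulphi := (fun x h => phi x * h)%g.
Local Notation mulphiV := (fun x h => (phi x)^-1 * h)%g.
Hypothesis phi_rel :
  forall u v, rel u v -> wact mulphi mulphiV u =1 wact mulphi mulphiV v.

Definition gen_lift (g : G) : H := gact mulphi mulphiV g 1%g.

Let phiK x : cancel (mulphi x) (mulphiV x).
Proof. by move=> h; rewrite mulKg. Qed.

Let phiVK x : cancel (mulphiV x) (mulphi x).
Proof. by move=> h; rewrite mulVKg. Qed.

Lemma gen_lift_gen x : gen_lift (gen rel x) = phi x.
Proof. by rewrite /gen_lift (gact_gen phiK phiVK phi_rel) mulg1. Qed.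

Lemma gen_liftM : {morph gen_lift : g h / g * h}%g.
Proof.
have M := gactM phiK phiVK phi_rel.
suff mulE g h : gact mulphi mulphiV g h = (gen_lift g * h)%g.
  by move=> g h; rewrite [LHS]M mulE.
rewrite /gen_lift; elim/presented_ind: g h => [h|x g IH h|x g IH h].
- by rewrite !(gact1 phiK phiVK phi_rel) mul1g.
- by rewrite !M IH !(gact_gen phiK phiVK phi_rel) mulgA.
- by rewrite !M IH !(gact_genV phiK phiVK phi_rel) mulgA.
Qed.

Lemma gen_lift1 : gen_lift 1%g = 1%g.
Proof. exact: (gact1 phiK phiVK phi_rel). Qed.

Lemma gen_liftV g : (gen_lift g^-1 = (gen_lift g)^-1)%g.
Proof.
by apply: (@mulgI _ (gen_lift g)); rewrite -gen_liftM !mulgV gen_lift1.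
Qed.

End PresentedMorphism.

(** * The bijective cocycle of an involutive solution *)

Section InvolutiveSolution.
Variable S : solution.
Hypothesis S_inv : involutive_solution S.
Local Notation r := (@sol_map S).
Local Notation s := (sigma r).
Local Notation t := (tau r).
Local Notation G := (structure_group S).
Local Notation iota := (@gen S (@structure_rel S)).

Lemma sigma_inj x : injective (s x).
Proof. exact/bij_inj/sol_sigma_bij. Qed.

Lemma tau_inj x : injective (t x).
Proof. exact/bij_inj/sol_tau_bij. Qed.

Definition sigmaV x : S -> S := invF (@sigma_inj x).

Lemma sigmaK x : cancel (s x) (sigmaV x).
Proof. exact: invF_f. Qed.

Lemma sigmaVK x : cancel (sigmaV x) (s x).
Proof. exact: f_invF. Qed.

Lemma sigma_tau x y : s (s x y) (t y x) = x.
Proof.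
have := S_inv (x, y); rewrite (surjective_pairing (r (x, y))).
by move/(congr1 fst).
Qed.

Lemma tau_tau x y : t (t y x) (s x y) = y.
Proof.
have := S_inv (x, y); rewrite (surjective_pairing (r (x, y))).
by move/(congr1 snd).
Qed.

(** The squaring map x |-> x . x of the cycle set x . y = sigma_x^-1 (y)
    attached to an involutive solution. *)
Definition diag x : S := sigmaV x x.

(** The pair (z, diag z) is fixed by r, so tau_(diag z) sends z to diag z:
    thus diag z determines z. *)
Lemma diag_inj : injective diag.
Proof.
move=> x y exy; have tauE z : t (diag z) z = diag z.
  by rewrite /diag; apply: (@sigma_inj z); rewrite -{1}(sigmaVK z z) sigma_tau sigmaVK.
by apply: (@tau_inj (diag x)); rewrite tauE exy tauE.
Qed.

Definition diagV : S -> S := invF diag_inj.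

Lemma diagVK x : sigmaV (diagV x) (diagV x) = x.
Proof. exact: (f_invF diag_inj). Qed.

Lemma lam_rel u v : structure_rel u v -> wact s sigmaV u =1 wact s sigmaV v.
Proof. by case=> x y z /=; rewrite sigma_yb. Qed.

Definition lam : G -> S -> S := gact s sigmaV.

Lemma lam1 x : lam 1%g x = x.
Proof. exact: (gact1 sigmaK sigmaVK lam_rel). Qed.

Lemma lamM g h x : lam (g * h)%g x = lam g (lam h x).
Proof. exact: (gactM sigmaK sigmaVK lam_rel). Qed.

Lemma lam_gen x y : lam (iota x) y = s x y.
Proof. exact: (gact_gen sigmaK sigmaVK lam_rel). Qed.

Lemma lam_genV x y : lam (iota x)^-1%g y = sigmaV x y.
Proof. exact: (gact_genV sigmaK sigmaVK lam_rel). Qed.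

Lemma lamK g : cancel (lam g) (lam g^-1%g).
Proof. exact: (gactK sigmaK sigmaVK lam_rel). Qed.

Lemma lamVK g : cancel (lam g^-1%g) (lam g).
Proof. exact: (gactVK sigmaK sigmaVK lam_rel). Qed.

Local Notation Z := {ffun S -> int}.

Definition basis x : Z := [ffun y => (y == x)%:R].
Definition move (g : G) (v : Z) : Z := [ffun y => v (lam g^-1%g y)].

Lemma move1 v : move 1%g v = v.
Proof. by apply/ffunP=> y; rewrite ffunE invg1 lam1. Qed.

Lemma moveM g h v : move (g * h)%g v = move g (move h v).
Proof. by apply/ffunP=> y; rewrite !ffunE invgM lamM. Qed.

Lemma moveD g u v : move g (u + v) = move g u + move g v.
Proof. by apply/ffunP=> y; rewrite !ffunE. Qed.

Lemma moveN g u : move g (- u) = - move g u.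
Proof. by apply/ffunP=> y; rewrite !ffunE. Qed.

Lemma move0 g : move g 0 = 0.
Proof. by apply/ffunP=> y; rewrite !ffunE. Qed.

Lemma moveK g : cancel (move g) (move g^-1%g).
Proof. by move=> v; rewrite -moveM mulVg move1. Qed.

Lemma move_basis g x : move g (basis x) = basis (lam g x).
Proof.
by apply/ffunP=> y; rewrite !ffunE -(can_eq (lamK g)) lamVK.
Qed.

(** The affine action whose translation part is the cocycle. *)
Definition aff x (v : Z) : Z := basis x + move (iota x) v.
Definition affV x (v : Z) : Z := move (iota x)^-1%g (v - basis x).

Lemma affK x : cancel (aff x) (affV x).
Proof. by move=> v; rewrite /aff /affV addrC addKr moveK. Qed.

Lemma affVK x : cancel (affV x) (aff x).
Proof.
by move=> v; rewrite /aff /affV -moveM mulgV move1 addrC subrK.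
Qed.

Lemma genM x y : (iota x * iota y = iota (s x y) * iota (t y x))%g.
Proof. by rewrite -!pi_cat; apply/presP/PresRel; constructor. Qed.

(** Both sides of the relation translate by e_x + e_(sigma_x y): this is where
    involutivity enters, as sigma_(sigma_x y) (tau_y x) = x. *)
Lemma aff_rel u v : structure_rel u v -> wact aff affV u =1 wact aff affV v.
Proof.
case=> x y v0 /=; rewrite /aff !moveD !addrA -!moveM genM !move_basis !lam_gen.
by rewrite sigma_tau (addrC (basis x)).
Qed.

Definition coc (g : G) : Z := gact aff affV g 0.

Lemma affE g v : gact aff affV g v = coc g + move g v.
Proof.
have M := gactM affK affVK aff_rel.
rewrite /coc; elim/presented_ind: g v => [v|x g IH v|x g IH v].
- by rewrite !(gact1 affK affVK aff_rel) move1 add0r.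
- by rewrite !M IH !(gact_gen affK affVK aff_rel) /aff moveD addrA moveM.
- rewrite !M IH !(gact_genV affK affVK aff_rel) /affV !moveD moveN moveM.
  by rewrite addrAC.
Qed.

Lemma cocM g h : coc (g * h)%g = coc g + move g (coc h).
Proof. by rewrite -affE /coc (gactM affK affVK aff_rel). Qed.

Lemma coc1 : coc 1%g = 0.
Proof. exact: (gact1 affK affVK aff_rel). Qed.

Lemma coc_gen x : coc (iota x) = basis x.
Proof. by rewrite /coc (gact_gen affK affVK aff_rel) /aff move0 addr0. Qed.

Lemma cocV g : coc g^-1%g = - move g^-1%g (coc g).
Proof. by apply/eqP; rewrite -addr_eq0 -cocM mulVg coc1. Qed.

(** Right multiplication by the one generator that adds e_x to the cocycle;
    decr is its inverse, for which the squaring map must be inverted. These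
    maps commute, so they make the lattice act on G, and the orbit map at 1 is
    the inverse of the cocycle. *)
Definition incr x (g : G) : G := (g * iota (lam g^-1%g x))%g.
Definition decr x (g : G) : G := (g * (iota (diagV (lam g^-1%g x)))^-1)%g.

Lemma decrK x : cancel (decr x) (incr x).
Proof.
move=> g; rewrite /incr /decr invgM invgK lamM lam_gen.
set z := lam _ x; have -> : s (diagV z) z = diagV z.
  by rewrite -{2}[z]diagVK sigmaVK.
by rewrite mulgVK.
Qed.

Lemma incrK x : cancel (incr x) (decr x).
Proof.
move=> g; rewrite /incr /decr invgM lamM lam_genV.
by set z := lam _ x; rewrite (_ : diagV _ = z) ?mulgK // /diagV (invF_f diag_inj).
Qed.

(** The relation u (u . v) = v (v . u) of the cycle set, multiplied by g. *)
Lemma incrC x y g : incr x (incr y g) = incr y (incr x g).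
Proof.
rewrite /incr !invgM !lamM !lam_genV; set u := lam _ x; set v := lam _ y.
rewrite -!mulgA; congr (g * _)%g; rewrite genM sigmaVK.
congr (_ * iota _)%g; apply: (@sigma_inj u).
by rewrite sigmaVK -{1}(sigmaVK v u) sigma_tau.
Qed.

Definition incrz x (k : int) (g : G) : G :=
  match k with Posz n => iter n (incr x) g | Negz n => iter n.+1 (decr x) g end.

Lemma incrzS x k g : incrz x (k + 1) g = incr x (incrz x k g).
Proof.
case: k => [n|n]; first by rewrite -[Posz n + 1]/(Posz (n + 1)) addn1.
rewrite [in RHS]/= decrK (_ : Negz n + 1 = - n%:Z); last by lia.
by case: n => // n; rewrite -NegzE.
Qed.

Lemma incrz_incr x y k g : incrz x k (incr y g) = incr y (incrz x k g).
Proof.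
case: k => n /=; first by elim: n => //= n ->; rewrite incrC.
have dC h : decr x (incr y h) = incr y (decr x h).
  by rewrite -{1}[h](decrK x) incrC incrK.
by elim: n => [|n IH] /=; rewrite ?IH dC.
Qed.

Definition from_coc (v : Z) : G := foldr (fun x => incrz x (v x)) 1%g (enum S).

Lemma from_cocD v x : from_coc (v + basis x) = incr x (from_coc v).
Proof.
rewrite /from_coc; have := enum_uniq S; have := mem_enum S x.
elim: (enum S) => //= y l IH; rewrite !inE; case: eqVneq => [->|xy] /=.
  move=> _ /andP[xl _]; rewrite !ffunE eqxx incrzS; congr (incr _ (incrz _ _ _)).
  move: xl; rewrite -has_pred1 => /hasPn xl.
  elim: l {IH} xl => //= z l IH xl; rewrite IH => [|a al]; last first.
    by apply: xl; rewrite inE al orbT.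
  have := xl z; rewrite inE eqxx /= => /(_ isT) /negPf zy.
  by rewrite !ffunE zy addr0.
move=> xl /andP[_ ul]; rewrite IH // incrz_incr.
by rewrite !ffunE eq_sym (negPf xy) addr0.
Qed.

Lemma from_coc0 : from_coc 0 = 1%g.
Proof. by rewrite /from_coc; elim: (enum S) => //= x l ->; rewrite ffunE. Qed.

(** Multiplying g by a generator x and increasing g at lam g x are the same
    operation. *)
Lemma cocK : cancel coc from_coc.
Proof.
have step g x : from_coc (coc (g * iota x)%g) = incr (lam g x) (from_coc (coc g)).
  by rewrite cocM coc_gen move_basis from_cocD.
elim/presented_ind_rev => [|x g IH|x g IH]; first by rewrite coc1 from_coc0.
  by rewrite step IH /incr lamK.
set h := (g * _)%g; apply: (can_inj (incrK (lam h x))).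
by rewrite -step mulgVK IH /incr lamK mulgVK.
Qed.

Lemma coc_incr x g : coc (incr x g) = coc g + basis x.
Proof. by rewrite cocM coc_gen move_basis lamVK. Qed.

Lemma coc_incrz x k g : coc (incrz x k g) = coc g + basis x *~ k.
Proof.
have cN h : coc (decr x h) = coc h - basis x.
  by rewrite -{2}[h](decrK x) coc_incr addrK.
case: k => n /=; last rewrite cN NegzE; elim: n => [|n IH] /=.
- by rewrite mulr0z addr0.
- by rewrite coc_incr IH -addrA -[in RHS]addn1 PoszD mulrzDr mulr1z.
- by rewrite mulrN1z.
- by rewrite cN IH -addrA -[- basis x]mulrN1z -mulrzDr; congr (_ + _ *~ _); lia.
Qed.

Lemma from_cocK : cancel from_coc coc.
Proof.
move=> v; have cE l : coc (foldr (fun x => incrz x (v x)) 1%g l) =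
    \sum_(x <- l) basis x *~ v x.
  elim: l => [|x l IH] /=; first by rewrite big_nil coc1.
  by rewrite big_cons coc_incrz IH addrC.
rewrite /from_coc cE big_enum /=; apply/ffunP=> y; rewrite sum_ffunE.
rewrite (bigD1 y) //= big1 => [|x xy]; rewrite ffunMzE ffunE.
  by rewrite eqxx addr0 intz.
by rewrite eq_sym (negPf xy) mul0rz.
Qed.

Lemma coc_inj : injective coc. Proof. exact: can_inj cocK. Qed.

End InvolutiveSolution.

(** * Multipermutation solutions have diffuse structure groups *)

Section SquaredNorm.
Variable T : finType.
Implicit Types u v : {ffun T -> int}.

Definition dot u v : int := \sum_x u x * v x.

Lemma dotC u v : dot u v = dot v u.
Proof. by apply: eq_bigr => x _; rewrite mulrC. Qed.

Lemma dotDl u v w : dot (u + v) w = dot u w + dot v w.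
Proof. by rewrite -big_split; apply: eq_bigr => x _; rewrite ffunE mulrDl. Qed.

Lemma dotNl u v : dot (- u) v = - dot u v.
Proof. by rewrite -sumrN; apply: eq_bigr => x _; rewrite ffunE mulNr. Qed.

Lemma dotDr u v w : dot w (u + v) = dot w u + dot w v.
Proof. by rewrite !(dotC w) dotDl. Qed.

Lemma dotNr u v : dot u (- v) = - dot u v.
Proof. by rewrite !(dotC u) dotNl. Qed.

Lemma dot_ge0 u : 0 <= dot u u.
Proof. by apply: sumr_ge0 => x _; rewrite -expr2 sqr_ge0. Qed.

Lemma dot_eq0 u : (dot u u == 0) = (u == 0).
Proof.
apply/eqP/eqP => [/eqP|->]; last by apply: big1 => x _; rewrite ffunE mul0r.
rewrite psumr_eq0 => [|x _]; last by rewrite -expr2 sqr_ge0.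
move=> /allP u0; apply/ffunP => x; rewrite ffunE; apply/eqP.
by have := u0 x (mem_index_enum x); rewrite /= mulf_eq0 orbb.
Qed.

Lemma dotDD u v : dot (u + v) (u + v) = dot u u + 2 * dot u v + dot v v.
Proof. by rewrite !dotDl !dotDr (dotC v u); ring. Qed.

End SquaredNorm.

Lemma fset_max (K : choiceType) (A : {fset K}) (f : K -> int) :
  A != fset0 -> exists2 a, a \in A & forall b, b \in A -> f b <= f a.
Proof.
case/fset0Pn => a0 Aa0.
case: (@arg_maxP _ _ _ [` Aa0]%fset xpredT (fun a => f (val a)) isT) => a _ amax.
by exists (val a); [exact: valP | move=> b Ab; apply: (amax [` Ab]%fset)].
Qed.

Section Extremal.
Variable S : solution.
Hypothesis S_inv : involutive_solution S.
Local Notation G := (structure_group S).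

(** For g acting trivially, coc (g a) = coc a + coc g and
    coc (g^-1 a) = coc a - coc g, and the squared norms of these two add up to
    more than twice that of coc a. *)
Lemma extremal_for_kernel (A : {fset G}) : A != fset0 ->
  exists2 a, a \in A & forall g, g != 1%g -> lam g =1 id ->
    (g * a)%g \notin A \/ (g^-1 * a)%g \notin A.
Proof.
move=> /(fset_max (fun a => dot (coc a) (coc a)))[a Aa amax]; exists a => // g g1 lg.
have mv v : move g v = v.
  by apply/ffunP=> x; rewrite ffunE -[in RHS](lamVK g x) lg.
have mVv v : move g^-1%g v = v by rewrite -{1}[v]mv moveK.
case: (boolP (_ \in A)) => [/amax|]; last by left.
rewrite (cocM S_inv) mv => le1; right; apply/negP=> /amax.
rewrite (cocM S_inv) (cocV S_inv) !mVv; move: le1; rewrite !dotDD !dotNl !dotNr.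
have : 0 < dot (coc g) (coc g).
  rewrite lt0r dot_ge0 dot_eq0 andbT; apply: contra_neq g1 => cg.
  by apply: (coc_inj S_inv); rewrite cg (coc1 S_inv).
lia.
Qed.

(** If g is not in the kernel, extremality in the image excludes it; otherwise
    multiplication by g stays in the fibre of a, where a was chosen extremal. *)
Lemma diffuse_ext (D : groupType) (phi : G -> D) :
  {morph phi : g h / g * h}%g -> (forall g, phi g = 1%g -> lam g =1 id) ->
  diffuse D -> diffuse G.
Proof.
move=> phiM ker_phi diffD A A0.
have phi1 : phi 1%g = 1%g by apply: (@mulgI _ (phi 1%g)); rewrite -phiM !mulg1.
have phiV g : phi g^-1%g = (phi g)^-1%g.
  by apply: (@mulgI _ (phi g)); rewrite -phiM !mulgV.
have [|b /imfsetP[/= a0 Aa0 ->] bext] := diffD [fset phi a | a in A]%fset.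
  by case/fset0Pn: A0 => a Aa; apply/fset0Pn; exists (phi a); rewrite in_imfset.
have [|a] := @extremal_for_kernel [fset a in A | phi a == phi a0]%fset.
  by apply/fset0Pn; exists a0; rewrite !inE Aa0 eqxx.
rewrite !inE => /andP[Aa /eqP pa] aext; exists a => // g g1.
have [pg|pg] := eqVneq (phi g) 1%g.
  have := aext g g1 (ker_phi g pg).
  by rewrite !inE !phiM phiV pg invg1 !mul1g pa eqxx !andbT.
case: (bext _ pg) => H; [left|right]; apply: contra H => H.
  by rewrite -pa -phiM in_imfset.
by rewrite -pa -phiV -phiM in_imfset.
Qed.

End Extremal.

Section RetractionMorphism.
Variable S : solution.
Hypothesis S_inv : involutive_solution S.
Local Notation s := (sigma (@sol_map S)).
Local Notation cl := (\pi_(ret_sort S)).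

Lemma ret_pi_surj (c : ret S) : exists x, cl x = c.
Proof. by exists (repr (c : ret_sort S)); apply: (@reprK _ (ret_sort S)). Qed.

Lemma ret_involutive : involutive_solution (ret S).
Proof.
move=> [c d]; have [x <-] := ret_pi_surj c; have [y <-] := ret_pi_surj d.
rewrite -[LHS]/(ret_map (ret_map (cl x, cl y))).
by rewrite !ret_mapE (sigma_tau S_inv) (tau_tau S_inv).
Qed.

Definition ret_gen (x : S) : structure_group (ret S) := gen _ (cl x : ret S).

Lemma ret_gen_rel u v : structure_rel u v ->
  wact (fun x h => ret_gen x * h)%g (fun x h => (ret_gen x)^-1 * h)%g u =1
  wact (fun x h => ret_gen x * h)%g (fun x h => (ret_gen x)^-1 * h)%g v.
Proof.
case=> x y h /=; rewrite !mulgA; congr (_ * _)%g.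
by rewrite /ret_gen genM /= ret_sigmaE ret_tauE.
Qed.

Definition ret_hom : structure_group S -> structure_group (ret S) :=
  @gen_lift _ _ _ ret_gen.

(** The structure group of the retraction still acts on S, a class acting by
    the sigma of any of its members, and lam factors through this action. *)
Lemma ret_hom_ker g : ret_hom g = 1%g -> lam g =1 id.
Proof.
pose f (c : ret S) := s (repr c); pose f' (c : ret S) := sigmaV (repr c).
have fcl x : f (cl x) =1 s x.
  by move=> z; have /ret_relP[H _] := ret_rel_repr x; apply: H.
have fK c : cancel (f c) (f' c) by apply: sigmaK.
have f'K c : cancel (f' c) (f c) by apply: sigmaVK.
have f_rel u v : structure_rel u v -> wact f f' u =1 wact f f' v.
  case=> c d z; have [x <-] := ret_pi_surj c; have [y <-] := ret_pi_surj d.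
  by rewrite /= ret_sigmaE ret_tauE !fcl sigma_yb.
suff lamE h : lam h =1 gact f f' (ret_hom h).
  by move=> hg z; rewrite lamE hg (gact1 fK f'K f_rel).
have homM := gen_liftM ret_gen_rel; have homV := gen_liftV ret_gen_rel.
have gE x : ret_hom (gen _ x) = ret_gen x by apply: (gen_lift_gen ret_gen_rel).
elim/presented_ind: h => [z|x h IH z|x h IH z].
- by rewrite [ret_hom _](gen_lift1 ret_gen_rel) lam1 (gact1 fK f'K f_rel).
- rewrite [ret_hom _]homM [gen_lift _ _]gE lamM IH (gactM fK f'K f_rel).
  by rewrite (gact_gen fK f'K f_rel) fcl lam_gen.
- rewrite [ret_hom _]homM homV [gen_lift _ (gen _ _)]gE lamM IH (gactM fK f'K f_rel).
  rewrite (gact_genV fK f'K f_rel) lam_genV; apply: (@sigma_inj _ x).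
  by rewrite -[in RHS]fcl f'K sigmaVK.
Qed.

End RetractionMorphism.

Lemma diffuse_of_iter_ret n (S : solution) : involutive_solution S ->
  #|iter n ret S| = 1%N -> diffuse (structure_group S).
Proof.
elim: n S => [|n IH] S S_inv.
  move=> /eqP/card1P[x0 xall] A A0.
  have [a Aa aext] := extremal_for_kernel S_inv A0.
  have x0E (x : S) : x = x0 by have := xall x; rewrite !inE => /esym/eqP.
  by exists a => // g g1; apply: aext => // x; rewrite [RHS]x0E [LHS]x0E.
rewrite iterSr => /(IH _ (ret_involutive S_inv)).
apply: (diffuse_ext S_inv); first exact: (gen_liftM (@ret_gen_rel S)).
exact: ret_hom_ker.
Qed.

(** * Irretractable quotients of solutions that are not multipermutation *)

Section SigmaDeterminesTau.
Variable S : solution.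
Hypothesis S_inv : involutive_solution S.
Local Notation s := (sigma (@sol_map S)).
Local Notation t := (tau (@sol_map S)).

(** The cycle set identity (c . z) . (c . w) = (z . c) . (z . w): its left-hand
    side depends on sigma_c only. *)
Lemma sigmaV_class a b z : s a =1 s b -> s (sigmaV z a) =1 s (sigmaV z b).
Proof.
move=> sab w; have tE c : t (sigmaV z c) z = sigmaV c z.
  by apply: (@sigma_inj _ c); rewrite -{1}(sigmaVK z c) (sigma_tau S_inv) sigmaVK.
have ybE c : s c (s (sigmaV c z) w) = s z (s (sigmaV z c) w).
  by rewrite -tE -{1}(sigmaVK z c) sigma_yb.
apply: (@sigma_inj _ z); rewrite -!ybE -sab; congr (s a (s _ w)).
by apply: (@sigma_inj _ a); rewrite sigmaVK sab sigmaVK.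
Qed.

(** S being finite, sigma_z is a power of its inverse; finv is applied to pairs
    so that both components use the same exponent. *)
Lemma sigma_class a b z : s a =1 s b -> s (s z a) =1 s (s z b).
Proof.
pose F (ab : S * S) := (sigmaV z ab.1, sigmaV z ab.2).
have F_inj : injective F.
  by move=> [a1 b1] [a2 b2] [/(can_inj (sigmaVK z)) -> /(can_inj (sigmaVK z)) ->].
have -> : s z a = (finv F (a, b)).1.
  by rewrite -[in RHS](sigmaK z a) -[in RHS](sigmaK z b) (finv_f F_inj (_, _)).
have -> : s z b = (finv F (a, b)).2.
  by rewrite -[in RHS](sigmaK z a) -[in RHS](sigmaK z b) (finv_f F_inj (_, _)).
move=> sab; rewrite /finv; elim: (_.-1) => //= n; exact: sigmaV_class.
Qed.

(** In an involutive solution tau_a (z) is the preimage of z under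
    sigma_(sigma_z a), which sigma_a determines. *)
Lemma ret_rel_sigma a b : s a =1 s b -> ret_rel a b.
Proof.
move=> sab; apply/ret_relP; split=> // z; apply: (@sigma_inj _ (s z a)).
by rewrite (sigma_tau S_inv) (sigma_class z sab) (sigma_tau S_inv).
Qed.

End SigmaDeterminesTau.

Definition morphism (S Y : solution) (p : S -> Y) : Prop :=
  forall x z, p (sigma (@sol_map S) x z) = sigma (@sol_map Y) (p x) (p z).

Definition irretractable (Y : solution) : Prop :=
  forall a b : Y, ret_rel a b -> a = b.

Lemma iter_ret_involutive n S :
  involutive_solution S -> involutive_solution (iter n ret S).
Proof. by move=> S_inv; elim: n => //= n; apply: ret_involutive. Qed.

Lemma iter_ret_pi n (S : solution) : exists p : S -> iter n ret S,
  morphism p /\ forall y, exists x, p x = y.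
Proof.
elim: n => [|n [p [pM p_surj]]]; first by exists id; split=> // y; exists y.
exists (\pi_(ret_sort (iter n ret S)) \o p); split=> [x z|c] /=.
  by rewrite pM ret_sigmaE.
have [y <-] := ret_pi_surj c; have [x <-] := p_surj y; by exists x.
Qed.

Lemma card_ret_le (S : solution) : (#|ret S| <= #|S|)%N.
Proof.
rewrite -(card_codom (f := fun c : ret S => repr (c : ret_sort S))).
  exact: max_card.
by apply: (can_inj (g := \pi_(ret_sort S))); apply: reprK.
Qed.

Lemma card_ret_eq (S : solution) : #|ret S| = #|S| -> irretractable S.
Proof.
move=> eqc a b /ret_piP; pose f (x : S) : ret S := \pi_(ret_sort S) x.
suff /injectiveP f_inj : injectiveb f by apply: f_inj.
rewrite /injectiveb /dinjectiveb -/(codom f); apply/card_uniqP.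
rewrite size_codom -eqc; apply: eq_card => c; rewrite inE.
by have [x <-] := ret_pi_surj c; apply/codomP; exists x.
Qed.

(** The cardinals of the iterated retractions cannot decrease forever. *)
Lemma irretractable_quotient (S : solution) : (0 < #|S|)%N ->
  ~ multipermutation S -> exists2 n, irretractable (iter n ret S) &
    (1 < #|iter n ret S|)%N.
Proof.
move=> S0 notMP.
have n1 n : #|iter n ret S| <> 1%N.
  move=> cn; have ex : exists n, #|iter n ret S| == 1%N by exists n; apply/eqP.
  case: (ex_minnP ex) => m /eqP cm mmin; apply: notMP; exists m; split=> // k km.
  by move=> /eqP /mmin; rewrite leqNgt km.
have n0 n : (0 < #|iter n ret S|)%N.
  have [p _] := iter_ret_pi n S; case/card_gt0P: S0 => x _.
  by apply/card_gt0P; exists (p x).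
have [n eqc] : exists n, #|ret (iter n ret S)| = #|iter n ret S|.
  apply: contrapT => /forallNP H.
  have dec n : (n + #|iter n ret S| <= #|S|)%N.
    elim: n => // n IH; apply: leq_trans IH.
    have := card_ret_le (iter n ret S); have := H n.
    by rewrite -[iter n.+1 ret S]/(ret (iter n ret S)); lia.
  by have := dec #|S|; have := n0 #|S|; lia.
by exists n; [exact: card_ret_eq | have := n0 n; have := n1 n; lia].
Qed.

(** * A nontrivial subgroup without fixed directions *)

Section BalancedSubgroups.
Variable S : solution.
Hypothesis S_inv : involutive_solution S.
Local Notation G := (structure_group S).
Local Notation s := (sigma (@sol_map S)).
Local Notation iota := (@gen S (@structure_rel S)).
Implicit Types (P Q : {set {ffun S -> S}}) (f u : {ffun S -> int}) (g h : G).

(** P ranges over sets of arbitrary self-maps, so that all self-maps can serve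
    as the starting point of the descent. *)
Definition invariant_under P f := forall m, m \in P -> forall x, f (m x) = f x.

Definition balanced P u := forall f, invariant_under P f -> dot f u = 0.

(** When induced P is contained in P, these elements form a subgroup. Its
    cocycles are the lattice vectors orthogonal to all P-invariant functions;
    if induced P = P, none but zero is fixed by its linear parts, since such a
    vector is itself P-invariant and hence orthogonal to itself. *)
Definition balanced_elt P g := balanced P (coc g).

Definition lamf g : {ffun S -> S} := [ffun x => lam g x].

Definition induced P : {set {ffun S -> S}} :=
  [set m | `[< exists2 g, balanced_elt P g & lamf g = m >]].

Lemma inducedP P m : reflect (exists2 g, balanced_elt P g & lamf g = m) (m \in induced P).
Proof. by rewrite inE; apply: asboolP. Qed.

Lemma induced_sub P Q : P \subset Q -> induced P \subset induced Q.
Proof.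
move=> /subsetP PQ; apply/subsetP=> m /inducedP[g Pg <-]; apply/inducedP.
by exists g => // f Qf; apply: Pg => n /PQ; apply: Qf.
Qed.

Lemma dot_move g f v : dot f (move g v) = dot (move g^-1%g f) v.
Proof.
rewrite /dot (reindex_inj (can_inj (lamK g))) /=.
by apply: eq_bigr => x _; rewrite !ffunE lamK invgK.
Qed.

Lemma dot_move2 g u v : dot (move g u) (move g v) = dot u v.
Proof. by rewrite dot_move moveK. Qed.

Section SubgroupOfInducedSub.
Variable P : {set {ffun S -> S}}.
Hypothesis subP : induced P \subset P.

Lemma balanced_elt_lam g f x :
  balanced_elt P g -> invariant_under P f -> f (lam g x) = f x.
Proof.
move=> Pg Pf; have /(subsetP subP)/Pf/(_ x) : lamf g \in induced P.
  by apply/inducedP; exists g.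
by rewrite ffunE.
Qed.

Lemma balanced_elt_move g f v : balanced_elt P g -> invariant_under P f ->
  dot f (move g v) = dot f v.
Proof.
move=> Pg Pf; rewrite dot_move; congr (dot _ v).
by apply/ffunP=> x; rewrite ffunE invgK (balanced_elt_lam _ Pg).
Qed.

Lemma balanced_elt1 : balanced_elt P 1%g.
Proof. by move=> f _; rewrite (coc1 S_inv) -(subrr 0) dotDr dotNr subrr. Qed.

Lemma balanced_eltM g h :
  balanced_elt P g -> balanced_elt P h -> balanced_elt P (g * h)%g.
Proof.
by move=> Pg Ph f Pf; rewrite (cocM S_inv) dotDr (balanced_elt_move _ Pg) // Pg // Ph.
Qed.

Lemma balanced_eltV g : balanced_elt P g -> balanced_elt P g^-1%g.
Proof.
move=> Pg f Pf; have := balanced_elt_move (coc g^-1%g) Pg Pf.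
by rewrite (cocV S_inv) moveN -moveM mulgV move1 !dotNr Pg // => <-; rewrite oppr0.
Qed.

End SubgroupOfInducedSub.

Section MovingFibres.
Variables (Y : solution) (p : S -> Y).
Hypothesis Y_inv : involutive_solution Y.
Hypothesis Y_irr : irretractable Y.
Hypothesis pM : morphism p.
Hypothesis p_surj : forall y, exists x, p x = y.

Definition moves P := exists m x, m \in P /\ p (m x) <> p x.

(** The inductive step of the descent. If m moves x to y, there is h in the
    subgroup with coc h = e_x - e_y. Were h trivial modulo p, then sigma_x and
    sigma_y' would agree modulo p, where h = x y'^-1 and h y' = y, hence so
    would sigma_x and sigma_y; irretractability of Y gives p x = p y. *)
Lemma moves_induced P : moves P -> moves (induced P).
Proof.
move=> [m [x [Pm pmx]]]; set y := m x in pmx.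
(* The choice of y' makes the cocycle of (iota y')^-1, transported by x, equal
   to - e_y. *)
pose y' := diagV S_inv (sigmaV x y); pose h := (iota x * (iota y')^-1)%g.
have dy' : sigmaV y' y' = sigmaV x y by rewrite diagVK.
have lamh z : lam h z = s x (sigmaV y' z) by rewrite lamM lam_gen lam_genV.
have coch : coc h = basis x - basis y.
  rewrite (cocM S_inv) (cocV S_inv) !(coc_gen S_inv) moveN !move_basis.
  by rewrite lam_genV dy' lam_gen sigmaVK.
have dot_basis f z : dot f (basis z) = f z.
  rewrite /dot (bigD1 z) //= big1 => [|w /negPf wz]; rewrite ffunE ?wz ?mulr0 //.
  by rewrite eqxx mulr1 addr0.
have Ph : balanced_elt P h.
  by move=> f Pf; rewrite coch dotDr dotNr !dot_basis Pf // subrr.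
apply: contrapT => nmove; apply: pmx.
have ph z : p (lam h z) = p z.
  apply: contrapT => phz; apply: nmove; exists (lamf h), z; split.
    by apply/inducedP; exists h.
  by rewrite ffunE.
have -> : p y = p y' by rewrite -(ph y') lamh dy' sigmaVK.
apply/esym/Y_irr/(ret_rel_sigma Y_inv) => c; have [z <-] := p_surj c.
by rewrite -!pM -(ph (s y' z)) lamh sigmaK.
Qed.

(** Constant maps suffice. *)
Lemma moves_setT : (1 < #|Y|)%N -> moves setT.
Proof.
case/card_gt1P=> a [b [_ _ /eqP ab]].
have [[x px] [z pz]] := (p_surj a, p_surj b).
exists [ffun=> x], z; rewrite ffunE px pz; split=> //; exact: in_setT.
Qed.

Lemma moves_fixed_point : (1 < #|Y|)%N -> exists2 P, induced P = P & moves P.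
Proof.
move=> /moves_setT; have : induced setT \subset setT by apply: subsetT.
move: {2}#|_|.+1 (ltnSn #|[set: {ffun S -> S}]|) => n.
elim: n setT => // n IH P cardP subP movP.
have [|nsub] := boolP (P \subset induced P).
  by move=> subP'; exists P => //; apply/eqP; rewrite eqEsubset subP.
apply: (IH (induced P)); [|exact: induced_sub|exact: moves_induced].
have /proper_card : induced P \proper P by rewrite properE subP.
by move/leq_trans; apply; rewrite -ltnS.
Qed.

End MovingFibres.
End BalancedSubgroups.

(** * Superlevel sets of integer vectors *)

Section IntegerVectors.
Variable T : finType.
Implicit Types u v : {ffun T -> int}.

(** Pigeonhole: below the value v x there are #|T| disjoint open intervals of
    length c, while only #|T| - 1 values remain to meet them. *)
Lemma exists_gap v (c : int) x : 0 <= c -> c * #|T|%:Z <= v x ->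
  exists2 theta : int, c <= theta <= v x &
    forall y, theta <= v y \/ v y <= theta - c.
Proof.
move=> c0 vx; apply: contrapT => nogap.
have inI (i : 'I_#|T|) : exists y, c * i%:Z < v y < c * (i%:Z + 1).
  apply: contrapT => /forallNP noy; apply: nogap; exists (c * (i%:Z + 1)).
    have := ltn_ord i; rewrite -(ltr_nat int) !natz; nia.
  move=> y; have [|yi] := lerP (c * (i%:Z + 1)) (v y); [by left|right].
  by have := noy y; rewrite yi andbT => /negP; rewrite -leNgt; lia.
have [f fI] := fin_all_exists inI.
have f_inj : injective f.
  move=> i j eij; apply: val_inj => /=.
  have := fI i; have := fI j; rewrite eij => /andP[h1 h2] /andP[h3 h4].
  have mono (k l : nat) : (k < l)%N -> c * (k%:Z + 1) <= c * l%:Z.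
    by move=> kl; rewrite ler_wpM2l //; lia.
  by case: (ltngtP i j) => // /mono; lia.
have /(inj_card_onto f_inj)/(_ x)/codomP[i ei] : (#|T| <= #|'I_#|T| |)%N.
  by rewrite card_ord.
have := fI i; rewrite -ei => /andP[_]; rewrite ltNge => /negP; apply.
by apply: le_trans vx; rewrite ler_wpM2l //; have := ltn_ord i; lia.
Qed.

(** The indicator of the superlevel set of v o h minus that of v. *)
Definition superlevel_diff (h : T -> T) v (theta : int) : {ffun T -> int} :=
  [ffun y => (theta <= v (h y))%R%:R - (theta <= v y)%R%:R].

Lemma dot_const_superlevel h v theta c : bijective h ->
  dot [ffun=> c] (superlevel_diff h v theta) = 0.
Proof.
move=> h_bij; rewrite /dot.
under eq_bigr do rewrite !ffunE mulrBr.
by rewrite sumrB [X in _ - X](reindex h) ?subrr //; apply: onW_bij.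
Qed.

(** Rearrangement: among the sets of a given size, the superlevel set of v has
    the largest v-sum, and the superlevel set of v o h the largest sum of
    v o h. The gap c below theta turns these inequalities into strict ones as
    soon as the two sets differ, which z witnesses. *)
Lemma superlevel_gap (h : T -> T) v (theta c : int) z : bijective h -> 0 <= c ->
  (forall y, theta <= v y \/ v y <= theta - c) ->
  v z < theta <= v (h z) ->
  let w := superlevel_diff h v theta in
  dot v w <= - c /\ c <= dot [ffun y => v (h y)] w.
Proof.
move=> h_bij c0 gap /andP[vz vhz] w.
(* The entries of w sum to zero, so a constant may be subtracted from u. With
   theta for v and theta - c for v o h, every term has the right sign and the
   term at z contributes at least c. *)
have shift u k : dot u w = \sum_y (u y - k) * w y.
  rewrite -[LHS]subr0 -[X in _ - X = _](dot_const_superlevel v theta k h_bij) /dot -sumrB.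
  by apply: eq_bigr => y _; rewrite ffunE mulrBl.
split.
  rewrite (shift v theta) (bigD1 z) //= -[leRHS]addr0 lerD //.
    by rewrite ffunE vhz (lt_geF vz) /= ?mulr1n ?mulr0n; have := gap z; lia.
  apply: sumr_le0 => y _; rewrite ffunE.
  have := gap y.
  case: (lerP theta (v y)); case: (lerP theta (v (h y))) => /=;
    rewrite ?mulr1n ?mulr0n; nia.
rewrite (shift _ (theta - c)) (bigD1 z) //= -[leLHS]addr0 lerD //.
  by rewrite !ffunE vhz (lt_geF vz) /= ?mulr1n ?mulr0n; lia.
apply: sumr_ge0 => y _; rewrite !ffunE.
have := gap (h y).
by case: (lerP theta (v y)); case: (lerP theta (v (h y))) => /=;
  rewrite ?mulr1n ?mulr0n; nia.
Qed.

Lemma dot_le u v (a b : int) : (forall y, `|u y| <= a) ->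
  (forall y, `|v y| <= b) -> `|dot u v| <= #|T|%:Z * (a * b).
Proof.
move=> ua vb; rewrite (le_trans (ler_norm_sum _ _ _)) //.
have -> : #|T|%:Z * (a * b) = \sum_(y : T) a * b.
  by rewrite sumr_const -mulr_natl natz.
by apply: ler_sum => y _; rewrite normrM ler_pM.
Qed.

Lemma sum0_norm_le u (m : int) : \sum_y u y = 0 -> (forall y, u y <= m) ->
  forall y, `|u y| <= #|T|%:Z * m.
Proof.
move=> u0 um y; have T0 : (0 < #|T|)%N by apply/card_gt0P; exists y.
have := u0; rewrite (bigD1 y) //= => uy.
have m0 : 0 <= m.
  have : \sum_y u y <= \sum_(y : T) m by apply: ler_sum.
  by rewrite u0 sumr_const -mulr_natl natz pmulr_rge0.
have : \sum_(z | z != y) u z <= \sum_(z | z != y) m by apply: ler_sum.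
rewrite sumr_const -mulr_natl natz cardC1; have := um y.
rewrite ler_norml; set n := #|T| in T0 *; move: T0; clearbody n.
case: n => // n _; rewrite /= intS mulrDl mul1r.
have nm0 : 0 <= n%:Z * m by rewrite mulr_ge0.
move=> uym sum_le; apply/andP; split; last by rewrite (le_trans uym) // lerDl.
by rewrite lerNl (addr0_eq uy) (le_trans sum_le) // lerDr.
Qed.

Lemma finite_ball (R : int) : exists A : {fset {ffun T -> int}},
  forall v, (v \in A) = (dot v v <= R).
Proof.
pose F (c : {ffun T -> 'I_(`|R|.*2.+1)}) : {ffun T -> int} :=
  [ffun y => (c y)%:Z - `|R|%:Z].
exists [fset v in [fset F c | c in predT] | dot v v <= R]%fset => v.
rewrite !inE; case: (lerP (dot v v) R) => [vR|]; last by rewrite andbF.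
rewrite andbT; apply/imfsetP.
have vy y : (absz (v y + `|R|%:Z)%R < `|R|.*2.+1)%N /\ 0 <= v y + `|R|%:Z.
  have : v y * v y <= R.
    apply: le_trans vR; rewrite /dot (bigD1 y) //= lerDl.
    by apply: sumr_ge0 => z _; rewrite -expr2 sqr_ge0.
  nia.
exists [ffun y => Ordinal (vy y).1] => //.
apply/ffunP=> y; rewrite !ffunE /= gez0_abs ?addrK //; exact: (vy y).2.
Qed.

End IntegerVectors.

(** * Balls without extremal points *)

Section NotDiffuse.
Variable S : solution.
Hypothesis S_inv : involutive_solution S.
Local Notation G := (structure_group S).
Implicit Types (g h k : G).

Lemma coc_kerM k h : lam k =1 id -> coc (k * h)%g = coc k + coc h.
Proof.
move=> lk; rewrite (cocM S_inv); congr (_ + _); apply/ffunP=> y.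
by rewrite ffunE -{2}(lamVK k y) lk.
Qed.

(** A factorial rather than the order of a quotient: it is divisible by every
    period that the pigeonhole argument below can produce. *)
Definition period : nat := (#|{ffun S -> S}|)`!.

(** Two of the elements with cocycles 0, w, 2 w, ... act in the same way on S;
    their quotient acts trivially and has a positive multiple of w as cocycle. *)
Lemma coc_ker_multiple (w : {ffun S -> int}) (q : nat) :
  exists2 k, coc k = w *+ (period * q) & lam k =1 id.
Proof.
pose F (i : 'I_#|{ffun S -> S}|.+1) := lamf (from_coc S_inv (w *+ i)).
have /injectivePn[i [j ij eF]] : ~~ injectiveb F.
  by apply/injectiveP => /leq_card; rewrite card_ord ltnn.
wlog lij : i j ij eF / (i < j)%N.
  move=> H; case: (ltngtP i j) => lij; [exact: (H i j)| |].
    by apply: (H j i) => //; rewrite eq_sym.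
  by case/eqP: ij; apply: val_inj.
set a := from_coc S_inv (w *+ j); set b := from_coc S_inv (w *+ i).
have lab x : lam a x = lam b x.
  by have := congr1 (fun m : {ffun S -> S} => m x) eF; rewrite !ffunE.
pose k0 := (a / b)%g.
have lk0 : lam k0 =1 id by move=> x; rewrite lamM lab lamVK.
have ck0 : coc k0 = w *+ (j - i).
  rewrite mulrnBr 1?ltnW // -(from_cocK S_inv (w *+ j)) -(from_cocK S_inv (w *+ i)).
  by rewrite -/a -/b -[a in RHS](mulgVK b) (coc_kerM _ lk0) addrK.
have kX n : coc (k0 ^+ n)%g = w *+ ((j - i) * n) /\ lam (k0 ^+ n)%g =1 id.
  elim: n => [|n [IH1 IH2]].
    by rewrite expg0 muln0 (coc1 S_inv); split=> // x; rewrite lam1.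
  rewrite expgS; split=> [|x]; last by rewrite lamM IH2 lk0.
  by rewrite (coc_kerM _ lk0) IH1 ck0 mulnS mulrnDr.
have [n en] : exists n, period = ((j - i) * n)%N.
  have /dvdnP[n ->] : (j - i %| period)%N.
    by apply: dvdn_fact; rewrite subn_gt0 lij /=; have := ltn_ord j; lia.
  by exists n; rewrite mulnC.
by exists (k0 ^+ (n * q))%g; have [c l] := kX (n * q)%N; rewrite ?en -?mulnA.
Qed.

Variable P : {set {ffun S -> S}}.
Hypothesis fixP : induced P = P.
Let subP : induced P \subset P. Proof. by rewrite fixP. Qed.

Local Notation Z := {ffun S -> int}.

Lemma balanced_sum0 u : balanced P u -> \sum_y u y = 0.
Proof.
move=> /(_ [ffun=> 1]); rewrite /dot; under eq_bigr do rewrite ffunE mul1r.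
by apply=> m _ x; rewrite !ffunE.
Qed.

(** The indicator of the orbit of x is an invariant function, so u sums to
    zero on this orbit. *)
Lemma orbit_drop u x : balanced P u -> 0 < u x ->
  exists2 h, balanced_elt P h & u (lam h x) <= 0.
Proof.
move=> bu ux; apply: contrapT => nodrop.
pose f : Z := [ffun y => `[< exists2 h, balanced_elt P h & lam h x = y >]%:R].
have f_inv : invariant_under P f.
  move=> m; rewrite -{1}fixP => /inducedP[g Pg <-] y; rewrite !ffunE; congr (_%:R).
  congr (nat_of_bool _); apply/asboolP/asboolP => -[h Ph].
    move=> hx; exists (g^-1 * h)%g; last by rewrite lamM hx lamK.
    by apply: (balanced_eltM S_inv subP) => //; apply: (balanced_eltV S_inv subP).
  by move=> <-; exists (g * h)%g; [exact: (balanced_eltM S_inv subP) | rewrite lamM].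
have := bu f f_inv; rewrite /dot (bigD1 x) //= => eq0.
have f_pos y : 0 <= f y * u y.
  rewrite ffunE; case: asboolP => [[h Ph hx]|]; last by rewrite mul0r.
  rewrite mul1r leNgt; apply/negP => uy; apply: nodrop; exists h => //.
  by rewrite hx ltW.
have fx : f x = 1.
  rewrite ffunE; case: asboolP => // nx; case: nx; exists 1%g; last exact: lam1.
  exact: balanced_elt1.
have : 0 <= \sum_(y | y != x) f y * u y by apply: sumr_ge0.
by rewrite -(addr0_eq eq0) fx mul1r oppr_ge0 leNgt ux.
Qed.

(** Only finitely many permutations of S occur as linear parts. *)
Lemma bounded_representatives : exists B : nat,
  forall h, balanced_elt P h -> exists2 h', balanced_elt P h' /\ lam h' =1 lam h &
    forall y, `|coc h' y| <= B%:Z.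
Proof.
have rep (m : {ffun S -> S}) : exists g, m \in P -> balanced_elt P g /\ lamf g = m.
  case: (boolP (m \in P)) => [|_]; last by exists 1%g.
  by rewrite -{1}fixP => /inducedP[g]; exists g.
have [F FP] := fin_all_exists rep.
exists (\sum_m \sum_y `|coc (F m) y|%N)%N => // h Ph.
have Pm : lamf h \in P by rewrite -fixP; apply/inducedP; exists h.
have [PF lF] := FP _ Pm; exists (F (lamf h)).
  by split=> // x; have := congr1 (fun m : {ffun S -> S} => m x) lF; rewrite !ffunE.
move=> y; rewrite -abszE lez_nat (bigD1 (lamf h)) //= (bigD1 y) //=; lia.
Qed.

(** The last two conditions say that u + coc h and u - h^-1 . coc h are not
    longer than u, expressed without inverses. *)
Definition shrinking (u : Z) h :=
  [/\ balanced_elt P h, h != 1%g,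
      2 * dot u (coc h) + dot (coc h) (coc h) <= 0
    & - 2 * dot (move h u) (coc h) + dot (coc h) (coc h) <= 0].

(** With n = #|S| and m the maximum of u, the gap c is about m / n. The element
    k h has cocycle N w + coc h with N = period * q. The term N w contributes at
    least N c to the two scalar products, against an error at most n^2 m D
    from coc h, and q is chosen so that the difference is at least c. The
    squared norm of N w + coc h is at most n B^2, which is below c for large
    m. *)
Lemma exists_shrinking : exists M : nat, forall u x, balanced P u ->
  M%:Z <= u x -> (forall y, u y <= u x) -> exists h, shrinking u h.
Proof.
have [D rep] := bounded_representatives.
pose n := #|S|; pose q := (2 * n ^ 3 * D + 1)%N.
pose B := (period * q + D)%N.
exists (n * (n * B ^ 2 + 1))%N => u x bu Mu umax.
have n0 : (0 < n)%N by apply/card_gt0P; exists x.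
pose c := (u x %/ n%:Z)%Z.
have c_big : (n * B ^ 2 + 1)%:Z <= c by rewrite lez_divRL ?ltz_nat // mulrC -PoszM.
have cx : c * n%:Z <= u x by apply: lez_floor; lia.
have ltc : u x < (c + 1) * n%:Z by apply: ltz_ceil; lia.
have c0 : 0 <= c by lia.
have [theta /andP[c_theta theta_x] gap] := exists_gap c0 cx.
(* Moving x to a coordinate where u is nonpositive crosses the level theta; h
   is a representative of bounded size with the same linear part. *)
have [h0 Ph0 drop] := orbit_drop bu (x := x) (ltac:(lia)).
have [h [Ph lh] hD] := rep _ Ph0.
have lhV z : lam h^-1%g z = lam h0^-1%g z.
  by rewrite -[in RHS](lamVK h z) lh lamK.
have hV_bij : bijective (lam h^-1%g) by exists (lam h); [exact: lamVK|exact: lamK].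
pose w := superlevel_diff (lam h^-1%g) u theta.
have [|uw huw] := superlevel_gap (z := lam h0 x) hV_bij c0 gap.
  by rewrite lhV lamK theta_x andbT; lia.
rewrite -/w -/(move h u) in uw huw.
have bw : balanced P w.
  move=> f Pf; pose i : Z := [ffun y => (theta <= u y)%R%:R].
  have -> : w = move h i - i by apply/ffunP=> y; rewrite !ffunE.
  by rewrite dotDr dotNr (balanced_elt_move subP) // subrr.
have [k ck lk] := coc_ker_multiple w q.
have ct : coc (k * h)%g = w *+ (period * q) + coc h by rewrite coc_kerM // ck.
have tB y : `|coc (k * h)%g y| <= B%:Z.
  have := hD y; rewrite ct !ffunE ffunMnE -mulr_natl natz ffunE /B.
  case: (theta <= _); case: (theta <= _) => /=;
    rewrite ?subr0 ?subrr ?sub0r ?mulr1 ?mulr0 ?mulrN1 PoszD;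
    move: (period * q)%N => N; lia.
have dotw v : dot v (w *+ (period * q)) = (period * q)%:Z * dot v w.
  rewrite /dot mulr_sumr; apply: eq_bigr => y _.
  by rewrite ffunMnE -mulr_natl natz mulrCA.
have un := sum0_norm_le (balanced_sum0 bu) umax.
have hun y : `|move h u y| <= n%:Z * u x by rewrite ffunE.
have dh := dot_le un hD; have dhh := dot_le hun hD; have dt := dot_le tB tB.
rewrite -/n in dh dhh dt.
have per0 : (0 < period)%N by apply: fact_gt0.
have key : n%:Z * (n%:Z * u x * D%:Z) + c <= (period * q)%:Z * c.
  have le1 : u x <= 2 * c * n%:Z by nia.
  have le2 : n%:Z * (n%:Z * u x * D%:Z) <= n%:Z * (n%:Z * (2 * c * n%:Z) * D%:Z).
    by rewrite ler_wpM2l // ler_wpM2r // ler_wpM2l.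
  have le3 : q%:Z * c <= (period * q)%:Z * c.
    by rewrite ler_wpM2r // lez_nat leq_pmull.
  apply: le_trans le3; apply: le_trans (lerD le2 (lexx c)) _.
  by rewrite /q PoszD !PoszM; lia.
have d1 : dot u (coc (k * h)%g) <= - c.
  by rewrite ct dotDr dotw; nia.
have d2 : c <= dot (move h u) (coc (k * h)%g).
  by rewrite ct dotDr dotw; nia.
have tt : dot (coc (k * h)%g) (coc (k * h)%g) <= c.
  by rewrite (le_trans (ler_norm _)) // (le_trans dt) //; lia.
exists (k * h)%g; split=> //.
- apply: (balanced_eltM S_inv subP) => // f Pf.
  by rewrite ck dotw (bw f Pf) mulr0.
- apply/eqP => kh1; move: d1; rewrite kh1 (coc1 S_inv) /dot.
  by under eq_bigr do rewrite ffunE mulr0; rewrite big1_eq; lia.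
- lia.
- have -> : move (k * h)%g u = move h u.
    apply/ffunP=> y; rewrite !ffunE; congr (u _).
    by rewrite invgM lamM -{2}(lamVK k y) lk.
  lia.
Qed.

(** If the coordinates of u = a^-1 . coc a exceed M somewhere, exists_shrinking
    shows that a is not extremal in the ball. If not, u is so short compared
    with the radius that the single element g1 shows it. *)
Lemma not_diffuse g1 : balanced_elt P g1 -> g1 != 1%g -> ~ diffuse G.
Proof.
move=> Pg1 g1N diffG; have [M shr] := exists_shrinking.
have [B1 B1P] : exists B1 : nat, forall y, `|coc g1 y| <= B1%:Z.
  by exists (\sum_y `|coc g1 y|%N)%N => y; rewrite (bigD1 y) //=; lia.
pose n := #|S|; pose L := (n * M + B1)%N.
pose R : int := n%:Z * (L%:Z * L%:Z).
have [A0 A0P] := finite_ball S R.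
pose A := [fset a in [fset from_coc S_inv v | v in A0] | `[< balanced_elt P a >]]%fset.
have AP a : a \in A <-> dot (coc a) (coc a) <= R /\ balanced_elt P a.
  rewrite !inE -A0P; split=> [/andP[/imfsetP[v /= Av ->] /asboolP Pa]|[Ac Pa]].
    by rewrite from_cocK.
  apply/andP; split; last exact/asboolP.
  by apply/imfsetP; exists (coc a) => //; rewrite cocK.
have [|a /AP[aR Pa] aext] := diffG A.
  apply/fset0Pn; exists 1%g; apply/AP; split; last exact: balanced_elt1.
  by rewrite (coc1 S_inv) [X in X <= _](_ : _ = 0) //; apply/eqP; rewrite dot_eq0.
pose u := move a^-1%g (coc a).
have bu : balanced P u.
  move=> f Pf; rewrite (balanced_elt_move subP) ?Pa //.
  exact: (balanced_eltV S_inv subP).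
have uu : dot u u <= R by rewrite dot_move2.
have cM h : coc (a * h)%g = move a (u + coc h).
  by rewrite (cocM S_inv) moveD -moveM mulgV move1.
suff [h [Ph h1 hR hVR]] : exists h, [/\ balanced_elt P h, h != 1%g,
    dot (u + coc h) (u + coc h) <= R & dot (u + coc h^-1%g) (u + coc h^-1%g) <= R].
  (* The translates of a by a h a^-1 and its inverse are a h and a h^-1. *)
  have [] := aext (a * h / a)%g.
  - apply: contra h1 => /eqP e.
    by rewrite -(mulKg a h) -[(a * h)%g](mulgVK a) e mul1g mulVg.
  - rewrite mulgVK => /negP; apply; apply/AP; rewrite cM dot_move2; split=> //.
    exact: (balanced_eltM S_inv subP).
  - rewrite !invgM invgK -!mulgA mulVg mulg1 => /negP; apply; apply/AP.
    rewrite cM dot_move2; split=> //.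
    by apply: (balanced_eltM S_inv subP) => //; apply: (balanced_eltV S_inv subP).
have cV h : coc h^-1%g = - move h^-1%g (coc h) by apply: cocV.
have [[x Mx]|/forallNP small] := pselect (exists x, M%:Z <= u x).
  have [x' _ x'max] := arg_maxP (P := xpredT) (fun y => u y) (i0 := x) isT.
  have [||h [Ph h1 d1 d2]] := shr u x' bu.
  - by apply: le_trans Mx _; apply: x'max.
  - by move=> y; apply: x'max.
  exists h; split=> //; rewrite dotDD.
    by lia.
  by rewrite cV !dotNr !dotNl dot_move2 dot_move invgK; lia.
have um y : u y <= M%:Z by have := small y => /negP; rewrite -ltNge => /ltW.
have un := sum0_norm_le (balanced_sum0 bu) um.
exists g1; split=> //; apply: le_trans (ler_norm _) _; apply: dot_le => y.
all: rewrite ffunE (le_trans (ler_normD _ _)) // /L PoszD PoszM lerD //.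
all: by rewrite cV !ffunE normrN.
Qed.

End NotDiffuse.

Theorem theorem7p11 (S : solution) (S_nonempty : (0 < #|S|)%N)
    (S_inv : involutive_solution S) :
  diffuse (structure_group S) <-> multipermutation S.
Proof.
split=> [diffG|[n [cn _]]]; last exact: diffuse_of_iter_ret S_inv cn.
apply: contrapT => /(irretractable_quotient S_nonempty)[n n_irr n_gt1].
have [p [pM p_surj]] := iter_ret_pi n S.
have [P fixP [m [x [Pm pmx]]]] := moves_fixed_point S_inv
  (@iter_ret_involutive n S S_inv) n_irr pM p_surj n_gt1.
move: Pm; rewrite -fixP => /inducedP[g Pg gm].
apply: (not_diffuse S_inv fixP Pg _ diffG).
by apply/eqP => g1; apply: pmx; rewrite -gm g1 ffunE lam1.
Qed.
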